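(* If $G$ is a finite, simple, connected graph of order $n(G)\geq 3$, then $\gamma_{r2}(G)+\gamma_R(G)\leq \frac{6}{4}n(G)$, with equality if and only if $G\in\mathcal{G}$.
   Context: For a positive integer $k$, $\mathcal{T}_k$ is the set of all trees $T$ obtained from $k$ vertex-disjoint paths $a_1b_1c_1d_1,\ldots,a_kb_kc_kd_k$ of order $4$ by adding edges between vertices of $\{b_1,\ldots,b_k\}$ so that the induced subgraph $T[\{b_1,\ldots,b_k\}]$ is a tree. The class $\mathcal{G}$ consists of the connected graphs $G$ that arise either from the unique tree in $\mathcal{T}_2$ (i.e. the paths $a_1b_1c_1d_1$, $a_2b_2c_2d_2$ plus the edge $b_1b_2$) by adding the edge $c_1c_2$, or from some tree in $\mathcal{T}_k$ (for some $k\geq 1$) by adding arbitrary edges between vertices of $\{b_1,\ldots,b_k\}$. A $2$-rainbow dominating function of a graph $G$ is a function $f:V(G)\to 2^{\{1,2\}}$ such that $\bigcup_{v\in N_G(u)}f(v)=\{1,2\}$ for every vertex $u$ with $f(u)=\emptyset$; its weight is $\sum_{u}|f(u)|$, and $\gamma_{r2}(G)$ is the minimum weight of such a function. A Roman dominating function of $G$ is a function $g:V(G)\to\{0,1,2\}$ such that every vertex $u$ with $g(u)=0$ has a neighbor $v$ with $g(v)=2$; its weight is $\sum_u g(u)$, and $\gamma_R(G)$ is the minimum weight of such a function. *)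

(* Defs.v *)
(* A finite simple graph is a symmetric irreflexive relation
   [e : rel V] on a finType [V] of vertices. *)
From mathcomp Require Import all_boot.

Set Implicit Arguments.
Unset Strict Implicit.
Unset Printing Implicit Defensive.

Section Graphs.
Variable V : finType.
Implicit Types (e : rel V) (A : {set V}).

Definition connected_graph e := forall x y : V, connect e x y.

(* [ucycle e [:: x; y]] holds as soon as [x] and [y] are adjacent, hence the
   lower bound on the length of a genuine cycle. *)
Definition acyclic e := forall c : seq V, 2 < size c -> ~ ucycle e c.

Definition is_tree e := connected_graph e /\ acyclic e.

Definition induced e A : rel {x : V | x \in A} :=
  [rel x y | e (val x) (val y)].

(* [e'] arises from [e] by adding (possibly no) edges between vertices
   of [A]. *)
Definition adds_edges_in A e e' :=
  [/\ symmetric e', irreflexive e', subrel e e'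
    & forall x y, e' x y -> ~~ e x y -> x \in A /\ y \in A].

Definition add_edge e (a b : V) : rel V :=
  [rel x y | [|| e x y, (x == a) && (y == b) | (x == b) && (y == a)]].

End Graphs.

Definition graph_iso (V W : finType) (e : rel V) (h : rel W) :=
  exists2 phi : V -> W, bijective phi & forall x y, h (phi x) (phi y) = e x y.

Section Domination.
Variables (V : finType) (e : rel V).

(* The two colours 1, 2 are the elements of ['I_2]. *)
Definition rainbow2_dominating (f : {ffun V -> {set 'I_2}}) : bool :=
  [forall u, (f u == set0) ==> (\bigcup_(v | e u v) f v == [set: 'I_2])].

Definition rainbow_weight (f : {ffun V -> {set 'I_2}}) : nat :=
  \sum_(u : V) #|f u|.

Definition gamma_r2 : nat :=
  rainbow_weight
    [arg min_(f < [ffun=> [set: 'I_2]] | rainbow2_dominating f)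
       rainbow_weight f].

Definition roman_dominating (g : {ffun V -> 'I_3}) : bool :=
  [forall u, (g u == 0 :> nat) ==> [exists v, e u v && (g v == 2 :> nat)]].

Definition roman_weight (g : {ffun V -> 'I_3}) : nat := \sum_(u : V) g u.

Definition gamma_R : nat :=
  roman_weight
    [arg min_(g < [ffun=> ord_max] | roman_dominating g) roman_weight g].

(* The constant functions used as default values above are dominating, so
   both numbers are attained minima. *)
Lemma gamma_r2P :
  (exists2 f, rainbow2_dominating f & rainbow_weight f = gamma_r2) /\
  (forall f, rainbow2_dominating f -> gamma_r2 <= rainbow_weight f).
Proof.
rewrite /gamma_r2; case: arg_minnP => [|f fP fmin].
  apply/forallP=> u; rewrite ffunE; apply/implyP=> /eqP/setP/(_ ord0).
  by rewrite !inE.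
by split=> //; exists f.
Qed.

Lemma gamma_RP :
  (exists2 g, roman_dominating g & roman_weight g = gamma_R) /\
  (forall g, roman_dominating g -> gamma_R <= roman_weight g).
Proof.
rewrite /gamma_R; case: arg_minnP => [|g gP gmin].
  by apply/forallP=> u; rewrite ffunE.
by split=> //; exists g.
Qed.

End Domination.

(* The vertices a_i, b_i, c_i, d_i are the pairs (i, 0), ..., (i, 3), with [i]
   counted from 0. *)
Definition vertex_b k (i : 'I_k) : 'I_k * 'I_4 := (i, @Ordinal 4 1 isT).
Definition vertex_c k (i : 'I_k) : 'I_k * 'I_4 := (i, @Ordinal 4 2 isT).

Definition disjoint_P4s k : rel ('I_k * 'I_4) :=
  [rel x y : 'I_k * 'I_4 | (x.1 == y.1) &&
             ((x.2.+1 == y.2 :> nat) || (y.2.+1 == x.2 :> nat))].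

Definition b_set k : {set 'I_k * 'I_4} := [set vertex_b i | i : 'I_k].

Definition in_T k (t : rel ('I_k * 'I_4)) :=
  [/\ is_tree t,
      adds_edges_in (b_set k) (@disjoint_P4s k) t
    & is_tree (@induced _ t (b_set k))].

(* Membership in the class is up to isomorphism, the trees of [in_T] having a
   fixed vertex set. *)
Definition in_G (V : finType) (e : rel V) :=
  connected_graph e /\
  ((exists2 t : rel ('I_2 * 'I_4), in_T t
      & graph_iso e (add_edge t (vertex_c ord0) (vertex_c ord_max)))
   \/
   (exists k : nat, 0 < k /\
      exists2 t : rel ('I_k * 'I_4), in_T t
        & exists2 h : rel ('I_k * 'I_4),
            adds_edges_in (b_set k) t h & graph_iso e h)).

(* Main.v *)
Require Import Defs.
From mathcomp Require Import all_boot all_order all_algebra.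
From mathcomp Require Import zify lra.

Set Implicit Arguments.
Unset Strict Implicit.
Unset Printing Implicit Defensive.

Import GRing.Theory Num.Theory.

(* Growing [G] one vertex at a time, its vertices can be partitioned into
   spiders: stars in which some edges at the center are subdivided once.  A
   spider with [p] legs of length 1 and [q] of length 2, [p + q >= 2], has two
   cheap dominating functions supported on it: one of weight [2 + q] that is
   Roman, hence also 2-rainbow dominating, and, if [p = 0], a 2-rainbow
   dominating one of weight [1 + q].  Comparing with [(1 + p + 2q) * 3/2]
   yields the bound, strictly unless [p = q = 1], i.e. unless the spider is a
   path of order 4.

   If equality holds, [G] is thus partitioned into paths of order 4, and no
   union of these paths has a domination cost below 3/2 of its order; in
   particular it has no partition into connected parts, of order at least 3,
   one of which has order not divisible by 4.  An edge leaving a path at its end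
   gives parts of orders 3 and 5; edges leaving a path at both inner vertices
   towards two different paths give parts of orders 6 and 6.  Hence all edges
   leaving a path do so at one fixed inner vertex, or [G] consists of two paths
   joined at both pairs of inner vertices.

   Conversely, the weight [w] of either kind of dominating function satisfies:
   if [w u = 0] then [w] sums to at least 2 over the neighbours of [u].  This
   alone forces weight 3 on each path of a member of the class. *)

(* [lia] would split on every boolean in sight, hence the generalization. *)
Ltac perm_count :=
  let P := fresh "P" in
  apply/permP => P;
  repeat match goal with H : _ |- _ => match type of H with
    is_true _ => clear H | _ = _ => clear H | _ /\ _ => clear H | _ \/ _ =>
      clear H end end;
  rewrite /= ?(count_cat, count_flatten) /= ?(count_cat, count_flatten) /=;
  repeat match goal with |- context [nat_of_bool ?b] =>
    generalize (nat_of_bool b); intro end;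
  lia.

(** * Decomposition into spiders *)

Section LocalDomination.
Variables (V : finType) (e : rel V).
Hypothesis e_sym : symmetric e.
Implicit Types (s t q : seq V) (f g : V -> {set 'I_2}) (ps : seq (V * V)).

(** Dominating neighbours are sought inside [s] only, so that functions chosen on disjoint sets can
    be combined. *)
Definition rainbow_on s f := forall u, u \in s -> f u = set0 ->
  forall i, exists2 v, v \in s & e u v && (i \in f v).

(* A Roman dominating function is encoded by a set-valued one, the value 0, 1
   or 2 being the cardinality; such a function is also 2-rainbow dominating. *)
Definition roman_on s g := forall u, u \in s -> g u = set0 ->
  exists2 v, v \in s & e u v && (g v == setT).

Definition weight s f := \sum_(u <- s) #|f u|.

(** An upper bound on the sum of both domination numbers of the subgraph induced by [s]; [cheap] and
    [slack] below compare it with 3/2 of the order. *)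
Definition cost s n := exists f, exists g,
  [/\ rainbow_on s f, roman_on s g & weight s f + weight s g <= n].

Definition cheap s := exists2 n, cost s n & 2 * n <= 3 * size s.
Definition slack s := exists2 n, cost s n & 2 * n < 3 * size s.

Lemma roman_on_rainbow s g : roman_on s g -> rainbow_on s g.
Proof.
move=> gR u us gu0 i; have [v vs /andP[euv /eqP gv]] := gR u us gu0.
by exists v; rewrite // euv gv inE.
Qed.

Lemma cost_perm s t n : perm_eq s t -> cost s n -> cost t n.
Proof.
move=> st [f [g [fR gR w]]]; have st' := perm_mem st.
exists f, g; split; last by rewrite /weight -!(perm_big _ st).
- by move=> u; rewrite -st' => us fu i; have [v] := fR u us fu i; exists v;
  rewrite -?st'.
- by move=> u; rewrite -st' => us fu; have [v] := gR u us fu; exists v; rewrite -?st'.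
Qed.

Lemma cheap_perm s t : perm_eq s t -> cheap s -> cheap t.
Proof.
by move=> st [n c h]; exists n; rewrite -?(perm_size st) //; apply: cost_perm c.
Qed.

Lemma slack_perm s t : perm_eq s t -> slack s -> slack t.
Proof.
by move=> st [n c h]; exists n; rewrite -?(perm_size st) //; apply: cost_perm c.
Qed.

Lemma slackW s : slack s -> cheap s.
Proof. by case=> n c /ltnW h; exists n. Qed.

(** * Gluing dominating functions on disjoint sets *)

Definition glue s f g u := if u \in s then f u else g u.

Lemma glueT s t f g v : uniq (s ++ t) -> v \in t -> glue s f g v = g v.
Proof.
rewrite cat_uniq => /and3P[_ /hasPn d _] vt.
by rewrite /glue; have /= /negbTE-> := d v vt.
Qed.

Lemma weight_glue s t f g : uniq (s ++ t) ->
  weight (s ++ t) (glue s f g) = weight s f + weight t g.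
Proof.
move=> st; rewrite /weight big_cat; congr (_ + _).
  by apply: eq_big_seq => u us; rewrite /glue us.
by apply: eq_big_seq => u ut; rewrite (glueT _ _ st).
Qed.

Lemma rainbow_glue s t f g : uniq (s ++ t) ->
  rainbow_on s f -> rainbow_on t g -> rainbow_on (s ++ t) (glue s f g).
Proof.
move=> st fR gR u; rewrite mem_cat; case: (boolP (u \in s)) => /= us.
  rewrite /glue us => _ fu i; have [v vs h] := fR u us fu i.
  by exists v; rewrite ?mem_cat vs.
move=> ut; rewrite (glueT _ _ st) // => gu i; have [v vt h] := gR u ut gu i.
by exists v; rewrite ?mem_cat ?vt ?orbT // (glueT _ _ st).
Qed.

Lemma roman_glue s t f g : uniq (s ++ t) ->
  roman_on s f -> roman_on t g -> roman_on (s ++ t) (glue s f g).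
Proof.
move=> st fR gR u; rewrite mem_cat; case: (boolP (u \in s)) => /= us.
  rewrite /glue us => _ fu; have [v vs h] := fR u us fu.
  by exists v; rewrite ?mem_cat vs.
move=> ut; rewrite (glueT _ _ st) // => gu; have [v vt h] := gR u ut gu.
by exists v; rewrite ?mem_cat ?vt ?orbT // (glueT _ _ st).
Qed.

(** Edges between the two parts can only help domination, so disjointness is enough. *)
Lemma cost_cat s t m n :
  uniq (s ++ t) -> cost s m -> cost t n -> cost (s ++ t) (m + n).
Proof.
move=> st [f [g [fR gR w]]] [f' [g' [fR' gR' w']]].
exists (glue s f f'), (glue s g g'); split.
- exact: rainbow_glue.
- exact: roman_glue.
- by rewrite !weight_glue //; lia.
Qed.

Lemma cheap_cat s t : uniq (s ++ t) -> cheap s -> cheap t -> cheap (s ++ t).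
Proof.
move=> st [m cs hs] [n ct ht]; exists (m + n); first exact: cost_cat.
by rewrite size_cat; lia.
Qed.

Lemma slack_catl s t : uniq (s ++ t) -> slack s -> cheap t -> slack (s ++ t).
Proof.
move=> st [m cs hs] [n ct ht]; exists (m + n); first exact: cost_cat.
by rewrite size_cat; lia.
Qed.

Lemma slack_catr s t : uniq (s ++ t) -> cheap s -> slack t -> slack (s ++ t).
Proof.
move=> st [m cs hs] [n ct ht]; exists (m + n); first exact: cost_cat.
by rewrite size_cat; lia.
Qed.

(* The spider with center [c], legs [c - x] for [x] in [s], and legs
   [c - m - z] for [(m, z)] in [ps]. *)
Definition legs c s ps := c :: s ++ unzip1 ps ++ unzip2 ps.

Definition spider c s ps :=
  [&& all (e c) s, all (fun p => e c p.1 && e p.1 p.2) ps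
    & 2 <= size s + size ps].

Lemma size_legs c s ps : size (legs c s ps) = (size s + 2 * size ps).+1.
Proof. by rewrite /= !size_cat !size_map; lia. Qed.

(** With [A = setT] this is the Roman function; with [A = [set ord_max]] it is the cheaper rainbow
    function for spiders without short legs. *)
Definition spider_fun A c ps u : {set 'I_2} :=
  if u == c then A else if u \in unzip2 ps then [set ord0] else set0.

Lemma spider_weight A c s ps : uniq (legs c s ps) ->
  weight (legs c s ps) (spider_fun A c ps) = #|A| + size ps.
Proof.
rewrite /legs /= mem_cat negb_or cat_uniq => /andP[/andP[cs cps] /and3P[_ sps ps2]].
move: cps; rewrite mem_cat negb_or => /andP[c1 c2].
move: ps2; rewrite cat_uniq => /and3P[_ /hasPn d _].
rewrite /weight big_cons {1}/spider_fun eqxx; congr (_ + _).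
have u2E : \sum_(u <- unzip2 ps) #|spider_fun A c ps u| = size ps.
  rewrite (eq_big_seq (fun=> 1)) => [|u u2].
    by rewrite big_const_seq count_predT iter_addn_0 mul1n size_map.
  rewrite /spider_fun u2 ifN ?cards1 //.
  by apply: contraNneq c2 => <-.
rewrite !big_cat /= u2E !big1_seq ?add0n // => u /=.
- move=> u1; rewrite /spider_fun ifN; last by apply: contraNneq c1 => <-.
  by rewrite ifN ?cards0 //; apply/negP => /d /=; rewrite u1.
- move=> us; rewrite /spider_fun ifN; last by apply: contraNneq cs => <-.
  rewrite ifN ?cards0 //; apply: contraNN sps => u2; apply/hasP; exists u => //.
  by rewrite mem_cat u2 orbT.
Qed.

Lemma set1_neq0 (T : finType) (x : T) : [set x] <> set0.
Proof. by move/setP/(_ x); rewrite !inE eqxx. Qed.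

Lemma spider_leaf c s ps u A : u \in legs c s ps -> A != set0 ->
  spider_fun A c ps u = set0 -> u \in s \/ u \in unzip1 ps.
Proof.
rewrite /legs inE !mem_cat /spider_fun => + A0.
case: eqP => /= [_ _ A0'|_]; first by rewrite A0' eqxx in A0.
case: ifP => _ /= => [_ /set1_neq0 //|].
by rewrite orbF => /orP[]; [left|right].
Qed.

Lemma spider_roman c s ps : spider c s ps ->
  roman_on (legs c s ps) (spider_fun setT c ps).
Proof.
case/and3P=> /allP es /allP eps _ u ul u0.
exists c; first by rewrite inE eqxx.
rewrite /spider_fun eqxx eqxx andbT e_sym.
have T0 : [set: 'I_2] != set0 by apply/set0Pn; exists ord0; rewrite inE.
by have [/es|/mapP[p /eps/andP[] + _ ->]] := spider_leaf ul T0 u0.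
Qed.

(** A middle vertex sees [ord_max] at the center and [ord0] at the end of its leg. *)
Lemma spider_rainbow c ps : spider c [::] ps -> c \notin unzip2 ps ->
  rainbow_on (legs c [::] ps) (spider_fun [set ord_max] c ps).
Proof.
case/and3P=> _ /allP eps _ c2 u ul u0 i.
have T0 : [set ord_max : 'I_2] != set0 by apply/set0Pn; exists ord_max; rewrite inE.
have [//|/mapP[p pp up]] := spider_leaf ul T0 u0.
have p2 : p.2 \in unzip2 ps by apply/mapP; exists p.
have /andP[e1 e2] := eps p pp.
(* A colour other than [ord_max] is lifted from ['I_1], hence equals [ord0]. *)
case: (unliftP ord_max i) => [j|] ->.
  exists p.2; first by rewrite /legs inE !mem_cat p2 !orbT.
  rewrite up e2 /spider_fun p2 ifN; last by apply: contraNneq c2 => <-.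
  by rewrite inE; apply/eqP/val_inj; case: j => [[]].
exists c; first by rewrite inE eqxx.
by rewrite up e_sym e1 /spider_fun eqxx inE.
Qed.

Lemma spider_cost c s ps : spider c s ps -> uniq (legs c s ps) ->
  cost (legs c s ps) (4 + 2 * size ps).
Proof.
move=> sp un; exists (spider_fun setT c ps), (spider_fun setT c ps).
have R := spider_roman sp; split=> //; first exact: roman_on_rainbow.
by rewrite spider_weight // cardsT card_ord; lia.
Qed.

Lemma legless_spider_cost c ps : spider c [::] ps -> uniq (legs c [::] ps) ->
  cost (legs c [::] ps) (3 + 2 * size ps).
Proof.
move=> sp un.
exists (spider_fun [set ord_max] c ps), (spider_fun setT c ps).
split.
- apply: spider_rainbow => //.
  by move: un; rewrite /= mem_cat negb_or => /andP[/andP[]].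
- exact: spider_roman.
- by rewrite !spider_weight // cardsT card_ord cards1; lia.
Qed.

(** Let there be [p] short and [q] long legs. For [p = 0] the claim is [6 + 4q < 3 + 6q], true as
    [q >= 2]; for [p > 0] it is [5 < 3p + 2q], which fails only if [p = q = 1]. *)
Lemma spider_slack c s ps : spider c s ps -> uniq (legs c s ps) ->
  ~~ ((size s == 1) && (size ps == 1)) -> slack (legs c s ps).
Proof.
move=> sp un; have /and3P[_ _ sz] := sp.
case: s sp un sz => [|x s] sp un sz h.
  exists (3 + 2 * size ps); first exact: legless_spider_cost.
  by rewrite size_legs /= in sz *; lia.
exists (4 + 2 * size ps); first exact: spider_cost.
by rewrite size_legs /= in sz h *; lia.
Qed.

Definition P4 q :=
  if q is [:: a; b; c; d] then [&& e a b, e b c & e c d] else false.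

Lemma P4_cheap q : P4 q -> uniq q -> cheap q.
Proof.
case: q => [|a [|b [|c [|d [|? ?]]]]] //= /and3P[ab bc cd] un.
(* The path is a spider with center [b], short leg [a] and long leg [c - d]. *)
have pe : perm_eq (legs b [:: a] [:: (c, d)]) [:: a; b; c; d] by perm_count.
apply: (cheap_perm pe); exists 6 => //.
apply: (@spider_cost b [:: a] [:: (c, d)]).
  by rewrite /spider /= e_sym ab bc cd.
by rewrite (perm_uniq pe).
Qed.

Lemma P4s_cheap (qs : seq (seq V)) :
  all P4 qs -> uniq (flatten qs) -> cheap (flatten qs).
Proof.
elim: qs => [_ _|q qs IH /= /andP[q4 qs4] un].
  exists 0 => //; exists (fun=> set0), (fun=> set0); split=> //.
  by rewrite /weight !big_nil.
have := un; rewrite cat_uniq => /and3P[uq _ uqs].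
apply: cheap_cat => //; [exact: P4_cheap | exact: IH].
Qed.

Lemma P4_size q : P4 q -> size q = 4.
Proof. by case: q => [|a [|b [|c [|d [|? ?]]]]]. Qed.

Lemma P4_rev q : P4 q -> P4 (rev q).
Proof.
case: q => [|a [|b [|c [|d [|? ?]]]]] //= /and3P[ab bc cd].
by rewrite /rev /= (e_sym d) (e_sym c b) (e_sym b a) ab bc cd.
Qed.

Lemma size_P4s (qs : seq (seq V)) : all P4 qs -> size (flatten qs) = 4 * size qs.
Proof.
by elim: qs => //= q qs IH /andP[/P4_size q4 /IH]; rewrite size_cat q4; lia.
Qed.

(** * Growing a partition into spiders *)

Inductive decomp : seq V -> Prop :=
| DecompNil : decomp [::]
| DecompCons c s ps t r : spider c s ps -> decomp t ->
    perm_eq r (legs c s ps ++ t) -> decomp r.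

Lemma decomp_perm r t : perm_eq r t -> decomp r -> decomp t.
Proof.
move=> + D; case: D => [|c s ps t' r' sp D pe] rt.
  by rewrite perm_sym in rt; move/perm_nilP: rt ->; constructor.
by apply: (DecompCons sp D); rewrite perm_sym in rt; apply: perm_trans pe.
Qed.

Lemma decomp1 c s ps : spider c s ps -> decomp (legs c s ps).
Proof. by move=> sp; apply: (DecompCons sp DecompNil); rewrite cats0. Qed.

Lemma decomp_cat s t : decomp s -> decomp t -> decomp (s ++ t).
Proof.
elim=> // c l ps s' r sp _ IH pe /IH D.
by apply: (DecompCons sp D); rewrite catA perm_cat2r.
Qed.

Lemma decomp_mem t y : decomp t -> y \in t ->
  exists c s ps r, [/\ spider c s ps, y \in legs c s ps, decomp r
    & perm_eq t (legs c s ps ++ r)].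
Proof.
elim=> // c s ps t' r sp D IH pe; rewrite (perm_mem pe) mem_cat.
case/orP => [yl|/IH [c' [s' [ps' [r' [sp' yl D' pe']]]]]].
  by exists c, s, ps, t'.
exists c', s', ps', (legs c s ps ++ r'); split=> //.
  exact: decomp_cat (decomp1 sp) D'.
apply: perm_trans pe _; apply: perm_trans (perm_cat (perm_refl _) pe') _.
by rewrite perm_catCA.
Qed.

Lemma spider_legs_perm c s ps s' ps' :
  perm_eq s s' -> perm_eq ps ps' -> spider c s ps ->
  spider c s' ps' /\ perm_eq (legs c s ps) (legs c s' ps').
Proof.
move=> ss pp; rewrite /spider (perm_all _ ss) (perm_all _ pp).
rewrite (perm_size ss) (perm_size pp) => ->; split=> //.
by rewrite /legs perm_cons !perm_cat ?perm_map.
Qed.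

(** At the center, [x] becomes a short leg; at a short leg, it makes that leg long. At a long leg
    [(m, z)], the vertices [x], [m], [z] are cut off, or the spider gets a new center. *)
Lemma decomp_spider_add c s ps x y :
  spider c s ps -> y \in legs c s ps -> e x y -> decomp (x :: legs c s ps).
Proof.
move=> sp yl xy; have yx : e y x by rewrite e_sym.
have /and3P[es eps sz] := sp.
move: yl; rewrite inE !mem_cat => /or3P[/eqP yc|ys|yps].
- have sp' : spider c (x :: s) ps by rewrite /spider /= -{1}yc yx es eps; lia.
  by apply: decomp_perm (decomp1 sp'); perm_count.
- have [sp' pe] := spider_legs_perm (perm_to_rem ys) (perm_refl ps) sp.
  move: (rem y s) sp' pe => s' sp' pe.
  have sp2 : spider c s' ((y, x) :: ps).
    by case/and3P: sp' => /= /andP[cy es'] _ sz'; rewrite /spider /= cy yx es' eps; lia.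
  apply: decomp_perm (decomp1 sp2).
  rewrite -(perm_cons x) perm_sym in pe; apply: perm_trans pe.
  by perm_count.
have [m [z [mz ymz]]] : exists m z, (m, z) \in ps /\ (y = m \/ y = z).
  by case/orP: yps => /mapP[[m z] mz ->]; exists m, z; split=> //; [left|right].
have [sp' pe] := spider_legs_perm (perm_refl s) (perm_to_rem mz) sp.
move: (rem _ ps) sp' pe => ps' sp' pe.
rewrite -(perm_cons x) perm_sym in pe; apply: decomp_perm pe _.
case/and3P: sp' => _ /= /andP[/andP[cm mz'] eps'] sz'.
have mc : e m c by rewrite e_sym.
have zm : e z m by rewrite e_sym.
(* The vertices [x], [m], [z] form a path of order 3 whose middle vertex [k] is [y]. *)
have [k [l [pk sk]]] : exists k l, perm_eq [:: k; l.1; l.2] [:: x; m; z] /\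
    spider k [:: l.1; l.2] [::].
  case: ymz => yE; rewrite yE in yx.
    by exists m, (x, z); split; [perm_count | rewrite /spider /= yx mz'].
  by exists z, (x, m); split; [perm_count | rewrite /spider /= yx zm].
have Dk : decomp [:: x; m; z] by apply: decomp_perm pk (decomp1 sk).
(* If at least two other legs remain, they still form a spider with center [c]. *)
have [big|small] := leqP 2 (size s + size ps').
  have sp'' : spider c s ps' by rewrite /spider es eps'.
  by apply: decomp_perm (decomp_cat Dk (decomp1 sp'')); perm_count.
have [[w [sE psE]]|[m' [z' [sE psE]]]] : (exists w, s = [:: w] /\ ps' = [::]) \/
    exists m' z', s = [::] /\ ps' = [:: (m', z')].
- have : size s + size ps' = 1.
    by apply/eqP; rewrite eqn_leq -ltnS small /=; rewrite -ltnS -addnS.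
  case: (s) => [|w [|? ?]]; case: (ps') => [|[m' z'] [|? ?]];
    rewrite /= ?addSn ?addnS //= => _.
    by right; exists m', z'.
  by left; exists w.
(* One short leg [w] remains: all vertices form a spider with center [m], in which [c - w] is a long
   leg. *)
- rewrite sE psE in es *; move: es => /= /andP[cl _].
  case: ymz => yE; rewrite yE in yx.
    have sp2 : spider m [:: x; z] [:: (c, w)] by rewrite /spider /= yx mz' mc cl.
    by apply: decomp_perm (decomp1 sp2); perm_count.
  have sp2 : spider m [::] [:: (c, w); (z, x)] by rewrite /spider /= yx mz' mc cl.
  by apply: decomp_perm (decomp1 sp2); perm_count.
(* One long leg remains: together with [c] it is a path of order 3 with middle vertex [m']. *)
- rewrite sE psE in eps' *; move: eps' => /= /andP[/andP[cm' mz''] _].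
  have sp2 : spider m' [:: c; z'] [::] by rewrite /spider /= e_sym cm' mz''.
  by apply: decomp_perm (decomp_cat Dk (decomp1 sp2)); perm_count.
Qed.

(** Read from the right, each vertex is adjacent to an earlier one; such an ordering certifies that
    [s] induces a connected subgraph. *)
Fixpoint grown s :=
  if s is x :: s' then ((s' == [::]) || has (e x) s') && grown s' else true.

Lemma grown_decomp s : grown s -> 2 < size s -> decomp s.
Proof.
elim: s => // x s IH /= /andP[xs gs]; rewrite ltnS leq_eqVlt => /predU1P[sz|sz].
  (* Base case: three connected vertices are spanned by a path, a spider with two short legs. *)
  case: s xs gs sz {IH} => [|y [|z []]] //= xyz /andP[]; rewrite !orbF in xyz *.
  move=> yz _ _; case/orP: xyz => xy.
    have sp : spider y [:: x; z] [::] by rewrite /spider /= e_sym xy yz.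
    by apply: decomp_perm (decomp1 sp); perm_count.
  have sp : spider z [:: x; y] [::] by rewrite /spider /= !(e_sym z) xy yz.
  by apply: decomp_perm (decomp1 sp); perm_count.
have D := IH gs sz; have /hasP[y ys xy] : has (e x) s.
  by case/orP: xs sz => // /eqP->.
(* Only the spider containing the neighbour [y] of [x] is rebuilt. *)
have [c [l [ps [r [sp yl Dr pe]]]]] := decomp_mem D ys.
have := decomp_cat (decomp_spider_add sp yl xy) Dr.
by apply: decomp_perm; rewrite /= perm_cons perm_sym.
Qed.

(** Every spider is cheap, so a single one that is not a path of order 4 makes the whole sequence
    slack. *)
Lemma decomp_slack_or_P4s t : decomp t -> uniq t ->
  slack t \/ exists2 qs, all P4 qs & perm_eq t (flatten qs).
Proof.
elim=> [_|c s ps t' r sp D IH pe]; first by right; exists [::].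
rewrite (perm_uniq pe) => un; have := un; rewrite cat_uniq => /and3P[ul _ ut].
have {}IH := IH ut.
case: (boolP ((size s == 1) && (size ps == 1))) => [/andP[]|h]; last first.
  left; rewrite perm_sym in pe; apply: slack_perm pe _; apply: slack_catl => //.
    exact: spider_slack.
  case: IH => [/slackW//|[qs qs4 pe']].
  by rewrite perm_sym in pe'; apply: (cheap_perm pe'); apply: P4s_cheap => //;
    rewrite (perm_uniq pe').
move: sp ul un pe; case: s => [|a []] //; case: ps => [|[m z] []] //.
set q := [:: a; c; m; z] => sp ul un pe _ _.
have q4 : P4 q by case/and3P: sp => /=; rewrite !andbT (e_sym c) => -> ->.
have pq : perm_eq (legs c [:: a] [:: (m, z)]) q by perm_count.
case: IH => [st|[qs qs4 pe']].
  left; rewrite perm_sym in pe; apply: slack_perm pe _; apply: slack_catr => //.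
  by apply: cheap_perm (P4_cheap q4 _); rewrite ?(perm_sym q) -?(perm_uniq pq).
right; exists (q :: qs); first exact/andP.
exact: perm_trans pe (perm_cat pq pe').
Qed.

Lemma grown_slack_or_P4s s : grown s -> 2 < size s -> uniq s ->
  slack s \/ exists2 qs, all P4 qs & perm_eq s (flatten qs).
Proof. by move=> gs sz; apply/decomp_slack_or_P4s/grown_decomp. Qed.

Lemma grown_cheap s : grown s -> 2 < size s -> uniq s -> cheap s.
Proof.
move=> gs sz us; have [/slackW//|[qs qs4 pe]] := grown_slack_or_P4s gs sz us.
by rewrite perm_sym in pe; apply: (cheap_perm pe); apply: P4s_cheap;
  rewrite ?(perm_uniq pe).
Qed.

Lemma grown_slack s : grown s -> 2 < size s -> uniq s -> ~~ (4 %| size s) ->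
  slack s.
Proof.
move=> gs sz us; have [//|[qs qs4 pe]] := grown_slack_or_P4s gs sz us.
by rewrite (perm_size pe) size_P4s // dvdn_mulr.
Qed.

End LocalDomination.

(** * Linked paths of order 4 *)

Section LinkedPaths.
Variables (V : finType) (e : rel V).
Hypothesis e_sym : symmetric e.
Implicit Types (s q : seq V).

Lemma grown_cons x y s : y \in s -> e x y -> grown e s -> grown e (x :: s).
Proof. by move=> ys xy /= ->; rewrite andbT; apply/orP; right; apply/hasP; exists y.
  Qed.

Lemma P4_grown q : P4 e q -> grown e q.
Proof.
by case: q => [|a [|b [|c [|d [|? ?]]]]] //= /and3P[-> -> ->].
Qed.

(** The end [a] changes sides: [b], [c], [d] stay connected, and [a :: q] has order 5. *)
Lemma end_link_slack a b c d q y : P4 e [:: a; b; c; d] -> P4 e q ->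
  uniq ([:: a; b; c; d] ++ q) -> y \in q -> e a y ->
  slack e ([:: a; b; c; d] ++ q).
Proof.
move=> /= /and3P[ab bc cd] q4 un yq ay.
have pe : perm_eq ([:: b; c; d] ++ (a :: q)) ([:: a; b; c; d] ++ q) by perm_count.
have un' : uniq ([:: b; c; d] ++ (a :: q)) by rewrite (perm_uniq pe).
apply: (slack_perm pe); have := un'; rewrite cat_uniq => /and3P[u1 _ u2].
have sz := P4_size q4.
apply: slack_catl => //.
  by apply: grown_slack => //=; rewrite bc cd.
apply: grown_cheap => //=; last by rewrite sz.
exact: grown_cons yq ay (P4_grown q4).
Qed.

(** All eight vertices form one spider with center [b], a single short leg and three long ones. *)
Lemma twin_link_slack a b c d a' b' c' d' :
  P4 e [:: a; b; c; d] -> P4 e [:: a'; b'; c'; d'] ->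
  uniq ([:: a; b; c; d] ++ [:: a'; b'; c'; d']) -> e b b' -> e b c' ->
  slack e ([:: a; b; c; d] ++ [:: a'; b'; c'; d']).
Proof.
move=> /= /and3P[ab bc cd] /and3P[ab' bc' cd'] un bb bc2.
have pe : perm_eq (legs b [:: a] [:: (c, d); (b', a'); (c', d')])
  ([:: a; b; c; d] ++ [:: a'; b'; c'; d']) by perm_count.
apply: (slack_perm pe); apply: spider_slack => //.
  by rewrite /spider /= (e_sym b a) (e_sym b' a') ab bc cd bb bc2 ab' cd'.
by rewrite (perm_uniq pe).
Qed.

(** The path is cut in the middle: [a], [b] join [q] and [c], [d] join [q'], giving two connected
    sets of order 6. *)
Lemma two_way_link_slack a b c d q q' y y' : P4 e [:: a; b; c; d] ->
  P4 e q -> P4 e q' -> uniq ([:: a; b; c; d] ++ q ++ q') ->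
  y \in q -> e b y -> y' \in q' -> e c y' ->
  slack e ([:: a; b; c; d] ++ q ++ q').
Proof.
move=> /= /and3P[ab bc cd] q4 q4' un yq by_ yq' cy.
have pe : perm_eq ((a :: b :: q) ++ (d :: c :: q')) ([:: a; b; c; d] ++ q ++ q').
  by perm_count.
have un' : uniq ((a :: b :: q) ++ (d :: c :: q')) by rewrite (perm_uniq pe).
apply: (slack_perm pe); have := un'; rewrite cat_uniq => /and3P[u1 _ u2].
have [sz sz'] := (P4_size q4, P4_size q4').
have g1 : grown e (a :: b :: q).
  by apply: (grown_cons (y := b)); rewrite ?inE ?eqxx // (grown_cons yq by_) ?P4_grown.
have g2 : grown e (d :: c :: q').
  apply: (grown_cons (y := c)); rewrite ?inE ?eqxx // 1?e_sym //.
  by rewrite (grown_cons yq' cy) ?P4_grown.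
by apply: slack_catl => //; [apply: grown_slack | apply: grown_cheap];
  rewrite //= ?sz ?sz'.
Qed.

(** Now [c] is the center of a spider with three short legs. *)
Lemma short_chord_slack a b c d : P4 e [:: a; b; c; d] ->
  uniq [:: a; b; c; d] -> e a c -> slack e [:: a; b; c; d].
Proof.
move=> /= /and3P[ab bc cd] un ac.
have pe : perm_eq (legs c [:: a; b; d] [::]) [:: a; b; c; d] by perm_count.
apply: (slack_perm pe); apply: spider_slack; rewrite ?(perm_uniq pe) //.
by rewrite /spider /= cd !(e_sym c) ac bc.
Qed.

(** On a 4-cycle, distinct colours at the opposite vertices [a] and [c] are rainbow dominating, and
    the values 2 and 1 there are Roman dominating. The total is [2 + 3 = 5 < 6]. *)
Lemma C4_slack a b c d : P4 e [:: a; b; c; d] -> uniq [:: a; b; c; d] ->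
  e a d -> slack e [:: a; b; c; d].
Proof.
rewrite /= !inE !negb_or => /and3P[ab bc cd].
case/and4P=> /and3P[nab nac nad] /andP[nbc nbd] ncd _ ad.
have [ba da ca] : [/\ (b == a) = false, (d == a) = false & (c == a) = false].
  by rewrite !(eq_sym _ a) !(negbTE nab, negbTE nac, negbTE nad).
have [bc_ dc] : (b == c) = false /\ (d == c) = false.
  by rewrite (eq_sym d) !(negbTE nbc, negbTE ncd).
have T0 : [set: 'I_2] != set0 by apply/set0Pn; exists ord0; rewrite inE.
pose f A B v : {set 'I_2} := if v == a then A else if v == c then B else set0.
have fE A B : (f A B a = A) * (f A B b = set0) * (f A B c = B) * (f A B d = set0).
  by rewrite /f eqxx ba ca da bc_ dc eqxx.
have zero A B u : A != set0 -> B != set0 -> u \in [:: a; b; c; d] ->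
    f A B u = set0 -> e u a /\ e u c.
  move=> A0 B0; rewrite !inE => /or4P[] /eqP->; rewrite !fE => fu.
  - by rewrite fu eqxx in A0.
  - by rewrite e_sym ab.
  - by rewrite fu eqxx in B0.
  - by rewrite !(e_sym d) ad cd.
have s1 (i : 'I_2) : [set i] != set0 by apply/set0Pn; exists i; rewrite inE.
exists 5 => //; exists (f [set ord0] [set ord_max]), (f setT [set ord0]); split.
- move=> u us fu i; have [ea ec] := zero _ _ _ (s1 _) (s1 _) us fu.
  case: (unliftP ord_max i) => [j|] ->.
    exists a; rewrite ?inE ?eqxx // ea !fE inE.
    by apply/eqP/val_inj; case: j => [[]].
  by exists c; rewrite ?inE ?eqxx ?orbT // ec !fE inE.
- move=> u us fu; have [ea _] := zero _ _ _ T0 (s1 _) us fu.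
  by exists a; rewrite ?inE ?eqxx // ea fE /=.
- by rewrite /weight !big_cons !big_nil !fE !cards1 cardsT card_ord !cards0.
Qed.

End LinkedPaths.

(** * Edges inside and between the paths of a tight partition *)

Section Blocks.
Variables (V : finType) (e : rel V).
Hypothesis e_sym : symmetric e.
Hypothesis e_tight : ~ slack e (enum V).
Variable k : nat.
Implicit Types (B : 'I_k -> nat -> V) (I : seq 'I_k).

(** Positions are natural numbers, so that numerals and the reversal [3 - j] need no bound
    proofs. *)
Definition block B i := [:: B i 0; B i 1; B i 2; B i 3].

Definition blocks B :=
  perm_eq (enum V) (flatten [seq block B i | i <- enum 'I_k]) /\
  forall i, P4 e (block B i).

Lemma blocks_split B I : blocks B -> uniq I -> exists I',
  perm_eq (enum V) (flatten [seq block B i | i <- I] ++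
                    flatten [seq block B i | i <- I']).
Proof.
move=> [pe _] uI; exists [seq i <- enum 'I_k | i \notin I].
rewrite -flatten_cat -map_cat; apply: perm_trans pe _.
apply/perm_flatten/perm_map/uniq_perm; first exact: enum_uniq.
  rewrite cat_uniq uI filter_uniq ?enum_uniq ?andbT //=.
  by apply/hasPn => i; rewrite mem_filter => /andP[].
by move=> i; rewrite mem_cat mem_filter !mem_enum !inE andbT orbN.
Qed.

Lemma blocks_uniq B I : blocks B -> uniq I ->
  uniq (flatten [seq block B i | i <- I]).
Proof.
move=> bB uI; have [I' pe] := blocks_split bB uI.
by have := enum_uniq V; rewrite (perm_uniq pe) cat_uniq => /and3P[].
Qed.

(** The remaining paths are cheap, so slack on some of the blocks would spread to the whole
    graph. *)
Lemma blocks_tight B I s : blocks B -> uniq I ->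
  perm_eq s (flatten [seq block B i | i <- I]) -> ~ slack e s.
Proof.
move=> bB uI ps /(slack_perm ps) sl; have [I' pe] := blocks_split bB uI.
have := enum_uniq V; rewrite (perm_uniq pe) => un.
apply: e_tight; rewrite perm_sym in pe; apply: (slack_perm pe).
apply: slack_catl => //; move: un; rewrite cat_uniq => /and3P[_ _ un].
apply: P4s_cheap => //; apply/allP => _ /mapP[i _ ->]; exact: bB.2.
Qed.

Lemma block_cross_end B i i' j' : blocks B -> i != i' -> j' < 4 ->
  ~ e (B i 0) (B i' j') /\ ~ e (B i 3) (B i' j').
Proof.
move=> bB ii' j4; have uI : uniq [:: i; i'] by rewrite /= inE ii'.
have yin : B i' j' \in block B i'.
  by case: j' j4 => [|[|[|[|//]]]] _; rewrite !inE eqxx ?orbT.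
have un := blocks_uniq bB uI; rewrite /= in un.
split=> xy.
  by apply: (blocks_tight bB uI (perm_refl _));
    apply: (end_link_slack e_sym _ _ un yin xy);
    apply: bB.2.
(* Reversing the block turns its last vertex into the first. *)
have pe : perm_eq (rev (block B i) ++ block B i') (flatten [seq block B i | i <- [:: i; i']]).
  by perm_count.
apply: (blocks_tight bB uI pe); have := bB.2 i => /(P4_rev e_sym) r4.
by apply: (end_link_slack e_sym r4 (bB.2 i') _ yin xy); rewrite (perm_uniq pe).
Qed.

Lemma block_cross_inner B i i' j j' : blocks B -> i != i' -> j < 4 -> j' < 4 ->
  e (B i j) (B i' j') -> j \in [:: 1; 2].
Proof.
move=> bB ii' j4 j4' xy; have [h0 h3] := block_cross_end bB ii' j4'.
by case: j j4 xy => [|[|[|[|]]]].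
Qed.

Lemma block_cross_twin B i i' j : blocks B -> i != i' -> j < 4 ->
  e (B i j) (B i' 1) -> ~ e (B i j) (B i' 2).
Proof.
move=> bB ii' j4 x1 x2; have uI : uniq [:: i; i'] by rewrite /= inE ii'.
have un := blocks_uniq bB uI; rewrite /= in un.
have := @block_cross_inner _ _ _ _ 1 bB ii' j4 isT x1.
rewrite !inE => /orP[] /eqP jE; rewrite {j j4}jE in x1 x2.
  by apply: (blocks_tight bB uI (perm_refl _));
    apply: (twin_link_slack e_sym _ _ un x1 x2);
    apply: bB.2.
have pe : perm_eq (rev (block B i) ++ block B i') (flatten [seq block B i | i <- [:: i; i']]).
  by perm_count.
apply: (blocks_tight bB uI pe); have := bB.2 i => /(P4_rev e_sym) r4.
by apply: (twin_link_slack e_sym r4 (bB.2 i') _ x1 x2); rewrite (perm_uniq pe).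
Qed.

(** Both endpoints in block [i'] are inner, and no vertex outside a block is joined to both of its
    inner vertices. *)
Lemma block_cross_inj B i i' j j1 j2 : blocks B -> i != i' -> j < 4 ->
  j1 < 4 -> j2 < 4 -> e (B i j) (B i' j1) -> e (B i j) (B i' j2) -> j1 = j2.
Proof.
move=> bB ii' j4 l1 l2 x1 x2; have i'i : i' != i by rewrite eq_sym.
have := x1; rewrite e_sym => /(block_cross_inner bB i'i l1 j4).
have := x2; rewrite e_sym => /(block_cross_inner bB i'i l2 j4).
rewrite !inE => /orP[] /eqP E2 /orP[] /eqP E1; rewrite ?E1 ?E2 //; move: x1 x2.
  by rewrite E1 E2 => x2 /(block_cross_twin bB ii' j4).
by rewrite E1 E2 => /(block_cross_twin bB ii' j4).
Qed.

Lemma block_cross_same B i i1 i2 j1 j2 : blocks B -> i != i1 -> i != i2 ->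
  j1 < 4 -> j2 < 4 -> e (B i 1) (B i1 j1) -> e (B i 2) (B i2 j2) -> i1 = i2.
Proof.
move=> bB n1 n2 l1 l2 x1 x2; apply/eqP/negP => /negP n12.
have uI : uniq [:: i; i1; i2] by rewrite /= !inE negb_or n1 n2 n12.
have un := blocks_uniq bB uI; rewrite /= in un.
have yin i' j' : j' < 4 -> B i' j' \in block B i'.
  by case: j' => [|[|[|[|//]]]] _; rewrite !inE eqxx ?orbT.
apply: (blocks_tight bB uI (perm_refl _)).
have := @two_way_link_slack _ _ e_sym _ _ _ _ (block B i1) (block B i2) _ _ (bB.2 i)
  (bB.2 i1) (bB.2 i2) un (yin i1 _ l1) x1 (yin i2 _ l2) x2.
by rewrite /=.
Qed.

(** A chord of the path would create a spanning claw or a 4-cycle, and both are slack. *)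
Lemma block_induced B i j j' : blocks B -> irreflexive e -> j < 4 -> j' < 4 ->
  e (B i j) (B i j') = (j.+1 == j') || (j'.+1 == j).
Proof.
move=> bB e_irr; have uI : uniq [:: i] by [].
have un := blocks_uniq bB uI; rewrite /= in un.
have /and3P[e01 e12 e23] := bB.2 i.
have h02 : e (B i 0) (B i 2) = false.
  apply/negP => h; apply: (blocks_tight bB uI (perm_refl _)).
  exact: (short_chord_slack e_sym (bB.2 i)).
have h03 : e (B i 0) (B i 3) = false.
  apply/negP => h; apply: (blocks_tight bB uI (perm_refl _)).
  exact: (C4_slack e_sym (bB.2 i)).
have h13 : e (B i 1) (B i 3) = false.
  have pe : perm_eq (rev (block B i)) (flatten [seq block B i | i <- [:: i]]) by perm_count.
  apply/negP => h; apply: (blocks_tight bB uI pe).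
  apply: (short_chord_slack e_sym (P4_rev e_sym (bB.2 i))); last by rewrite e_sym.
  by rewrite (perm_uniq pe).
have e10 : e (B i 1) (B i 0) by rewrite e_sym.
have e21 : e (B i 2) (B i 1) by rewrite e_sym.
have e32 : e (B i 3) (B i 2) by rewrite e_sym.
have h20 : e (B i 2) (B i 0) = false by rewrite e_sym.
have h30 : e (B i 3) (B i 0) = false by rewrite e_sym.
have h31 : e (B i 3) (B i 1) = false by rewrite e_sym.
by case: j => [|[|[|[|//]]]] _; case: j' => [|[|[|[|//]]]] _;
  rewrite ?e_irr ?e01 ?e12 ?e23 ?e10 ?e21 ?e32 ?h02 ?h03 ?h13 ?h20 ?h30 ?h31.
Qed.

Definition vertex B (x : 'I_k * 'I_4) := B x.1 x.2.

Lemma blocks_card B : blocks B -> #|V| = 4 * k.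
Proof.
case=> pe b4; rewrite cardE (perm_size pe) (size_P4s (e := e)).
  by rewrite size_map size_enum_ord.
by apply/allP => _ /mapP[i _ ->].
Qed.

Lemma vertex_bij B : blocks B -> bijective (vertex B).
Proof.
move=> bB; have surj v : exists x, vertex B x == v.
  have : v \in enum V by rewrite mem_enum.
  rewrite (perm_mem bB.1) => /flattenP[_ /mapP[i _ ->]].
  rewrite !inE => /or4P[] /eqP->;
    [exists (i, inord 0) | exists (i, inord 1) | exists (i, inord 2) | exists (i, inord 3)];
    by rewrite /vertex /= inordK.
(* A right inverse is injective, and the count [#|V| = 4 * k] makes it bijective. *)
have [psi psiK] : exists psi, cancel psi (vertex B).
  by exists (fun v => xchoose (surj v)) => v; apply/eqP/(xchooseP (surj v)).
have [phi phiK psiK'] : bijective psi.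
  apply: inj_card_bij; first exact: can_inj psiK.
  by rewrite card_prod !card_ord (blocks_card bB); lia.
by exists psi => // x; rewrite -{1}(psiK' x) psiK psiK'.
Qed.

(** Reversing selected paths normalizes which inner vertex carries the outgoing edges. *)
Definition flip (fl : 'I_k -> bool) B i j := B i (if fl i then 3 - j else j).

Lemma blocks_flip fl B : blocks B -> blocks (flip fl B).
Proof.
have fE i : block (flip fl B) i = if fl i then rev (block B i) else block B i.
  by rewrite /block /flip; case: (fl i).
case=> pe b4; split=> [|i]; last by rewrite fE; case: (fl i) => //; apply: P4_rev.
apply: perm_trans pe _; apply/permP => P; rewrite !count_flatten -!map_comp.
congr (sumn _); apply: eq_map => i;
  change (count P (block B i) = count P (block (flip fl B) i)).
by rewrite fE; case: (fl i); rewrite /= ?addn0; lia.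
Qed.

End Blocks.

(** * Spanning trees *)

Section Trees.
Variable T : finType.
Implicit Types (e t : rel T) (rho : T -> nat).

(** A certificate of acyclicity: [rho] acts as the depth in a rooted forest, the only neighbour of
    no larger rank being the parent. *)
Definition ranked e rho := forall x y z,
  e x y -> e x z -> rho y <= rho x -> rho z <= rho x -> y = z.

(* At a vertex of maximal rank, both neighbours along the cycle would have
   smaller or equal rank. *)
Lemma ranked_acyclic e rho : symmetric e -> ranked e rho -> acyclic e.
Proof.
move=> e_sym rk [//|a c] sz uc.
case: (arg_maxnP rho (mem_head a c)) => x xc xmax.
have /rot_to[n s rotE] : x \in a :: c := xc.
have memE : x :: s =i a :: c by move=> y; rewrite -rotE mem_rot.
move: uc sz; rewrite -(rot_ucycle n) -(size_rot n) rotE => /andP[].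
case: s memE {rotE} => [|y s] // memE; case/lastP: s memE => [|s z] // memE.
rewrite /= rcons_path last_rcons => /and3P[xy _ zx] /andP[_ /andP[yz _]] _.
suff yzE : y = z by rewrite yzE mem_rcons inE eqxx in yz.
apply: (rk x) => //; first by rewrite e_sym.
  by apply: xmax; change (y \in a :: c); rewrite -memE !inE eqxx orbT.
by apply: xmax; change (z \in a :: c); rewrite -memE !inE mem_rcons inE eqxx !orbT.
Qed.

Lemma connected_grown e : connected_graph e -> 0 < #|T| ->
  exists s, [/\ grown e s, uniq s & forall x, x \in s].
Proof.
move=> e_conn T0.
have H n : n < #|T| -> exists s, [/\ grown e s, uniq s & size s = n.+1].
  elim: n => [_|n IH n1].
    by have /card_gt0P[x _] := T0; exists [:: x].
  have [s [gs us sz]] := IH (ltnW n1).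
  have [x xs] : exists x, x \notin s.
    apply/existsP; rewrite -negb_forall; apply: contraL n1 => /forallP all_s.
    rewrite -leqNgt -sz -(card_uniqP us); apply: subset_leq_card.
    by apply/subsetP => y _; apply: all_s.
  have [y ys] : exists y, y \in s by case: (s) sz => // y ? _; exists y;
    rewrite inE eqxx.
  (* A path from [x] into [s] has a vertex outside [s] whose successor lies in [s]; that vertex
     extends [s]. *)
  have /connectP[p] := e_conn x y; elim: p x xs => [|z p IHp] x xs /=.
    by move=> _ yx; rewrite -yx ys in xs.
  move=> /andP[xz pz] yl; case: (boolP (z \in s)) => [zs|/IHp]; last exact.
  by exists (x :: s); rewrite /= sz xs us gs; split=> //; rewrite andbT; apply/orP;
    right; apply/hasP; exists z.
have [s [gs us sz]] : exists s, [/\ grown e s, uniq s & size s = #|T|.-1.+1].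
  by apply: H; lia.
exists s; split=> // x; rewrite prednK // in sz.
have : s =i T by apply/subset_cardP; [rewrite (card_uniqP us) | apply/subsetP].
by move->.
Qed.

(** In a grown ordering each vertex but the last has a neighbour further right; one such neighbour
    is picked as its parent. The last vertex is the root, and ranks decrease to the right. *)
Lemma spanning_tree e : connected_graph e -> symmetric e -> irreflexive e ->
  exists t rho, [/\ subrel t e, symmetric t, connected_graph t & ranked t rho].
Proof.
move=> e_conn e_sym e_irr.
have [T0|/card_gt0P[r0 _]] := posnP #|T|.
  by exists e, (fun=> 0); split=> // x; have := card0_eq T0 x; rewrite !inE.
have [s [gs us sT]] : exists s, [/\ grown e s, uniq s & forall x, x \in s].
  by apply: connected_grown => //; apply/card_gt0P; exists r0.
pose p x := [pick y | e x y && (index x s < index y s)].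
pose t x y := (p x == Some y) || (p y == Some x).
pose r := last r0 s.
have pE x y : p x = Some y -> e x y /\ index x s < index y s.
  by rewrite /p; case: pickP => // z /andP[? ?] [<-].
have tsym : symmetric t by move=> x y; rewrite /t orbC.
exists t, (fun x => size s - index x s); split=> //.
- move=> x y /orP[] /eqP/pE[] // yx _; by rewrite e_sym.
- have pS x : x = r \/ exists y, p x = Some y.
    case: (eqVneq x r) => [|xr]; [by left|right].
    rewrite /p; case: pickP => [y _|no]; first by exists y.
    have : exists2 y, y \in s & e x y && (index x s < index y s).
      move: (sT x) us gs xr; rewrite /r; clear; elim: s r0 => // z s IH r0 /=.
      rewrite inE; case: (eqVneq x z) =>
        [-> _ /andP[zs us]|xz /= xs /andP[zs us] /andP[_ gs]].
        case: s zs us {IH} => [|w s] zs us /=; first by rewrite eqxx.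
        move=> /andP[zws _] _; have [y ys zy] : exists2 y, y \in w :: s & e z y.
          by apply/hasP.
        exists y; rewrite ?inE ?zy; first by rewrite -in_cons ys orbT.
        by rewrite ifN //; apply: contraNneq zs => ->.
      move=> xr; have [y ys /andP[xy lt]] := IH z xs us gs xr.
      exists y; first by rewrite inE ys orbT.
      by rewrite xy ifN //; apply: contraNneq zs => ->.
    by case=> y _ h; have := no y; rewrite h.
  (* Passing to the parent lowers the rank, so iterating it ends at the root. *)
  have toR x : connect t x r.
    have [n] := ubnP (size s - index x s); elim: n x => // n IH x lt.
    case: (pS x) => [->|[y xy]]; first exact: connect0.
    have [exy ltxy] := pE _ _ xy; apply: connect_trans (connect1 _) (IH y _).
      by rewrite /t xy eqxx.
    by rewrite -ltnS; apply: leq_trans lt; rewrite ltnS ltn_sub2l // index_mem.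
  move=> x y; apply: connect_trans (toR x) _.
  by rewrite (sym_connect_sym tsym).
(* A neighbour of no larger rank cannot be a child, hence is the parent. *)
- have up x y : t x y -> size s - index y s <= size s - index x s -> p x = Some y.
    case/orP => /eqP // yx lt; have [_ lt'] := pE _ _ yx.
    by move: lt; rewrite leqNgt ltn_sub2l // index_mem.
  by move=> x y z xy xz yx zx; have := up _ _ xz zx; rewrite (up _ _ xy yx) => -[].
Qed.

End Trees.

(** * Structure of the extremal graphs *)

Lemma connect_homo (T T' : finType) (e : rel T) (e' : rel T') (f : T -> T') :
  (forall x y, e x y -> connect e' (f x) (f y)) ->
  forall x y, connect e x y -> connect e' (f x) (f y).
Proof.
move=> ef x y /connectP[p]; elim: p x => [|z p IH] x /= => [_ ->|];
  first exact: connect0.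
by case/andP=> /ef xz pz yl; apply: connect_trans xz (IH z pz yl).
Qed.

Lemma ord2_neq (i j : 'I_2) : i != j ->
  (i = ord0 /\ j = ord_max) \/ (i = ord_max /\ j = ord0).
Proof.
by case: i j => [[|[|//]] p] [[|[|//]] q] // _; [left|right]; split; apply: val_inj.
Qed.

(** * Construction of members of the class from a backbone *)

Section PathsOnTree.
Variable k : nat.
Implicit Types x y : 'I_k * 'I_4.

Lemma vertex_eq x y : x.1 = y.1 -> x.2 = y.2 :> nat -> x = y.
Proof. by case: x y => [i j] [i' j'] /= -> /val_inj->. Qed.

Lemma mem_b_set x : (x \in b_set k) = (x.2 == 1 :> nat).
Proof.
apply/imsetP/eqP => [[i _ ->] //|x1]; exists x.1 => //; exact: vertex_eq.
Qed.

(** For a tree [t] this is the tree in the class with [t] copied onto the vertices [b_i]. *)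
Definition hang (t : rel 'I_k) : rel ('I_k * 'I_4) :=
  [rel x y | disjoint_P4s x y ||
             [&& x.2 == 1 :> nat, y.2 == 1 :> nat & t x.1 y.1]].

Lemma hang_in_T t rho : irreflexive t -> symmetric t -> connected_graph t ->
  ranked t rho -> in_T (hang t).
Proof.
move=> t_irr t_sym t_conn rk.
have P_sym : symmetric (@disjoint_P4s k) by move=> x y;
  rewrite /disjoint_P4s /= eq_sym orbC.
have h_sym : symmetric (hang t).
  by move=> x y; have := P_sym x y; rewrite /hang /= t_sym => ->; rewrite andbCA.
have b_adj x y : x.2 = 1 :> nat -> y.2 = 1 :> nat -> hang t x y = t x.1 y.1.
  by rewrite /hang /disjoint_P4s /= => -> ->; rewrite /= andbF.
split.
- split.
    have to_b x : connect (hang t) x (vertex_b x.1).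
      have step y z : disjoint_P4s y z -> connect (hang t) y z.
        by move=> yz; apply: connect1; rewrite /hang /= yz.
      case: x => i [[|[|[|[|//]]]] j4] /=.
      + by apply: step; rewrite /disjoint_P4s /= eqxx.
      + by rewrite (_ : (i, _) = vertex_b i) //; apply: vertex_eq.
      + by apply: step; rewrite /disjoint_P4s /= eqxx.
      + by apply: (@connect_trans _ _ (vertex_c i)); apply: step;
        rewrite /disjoint_P4s /= eqxx.
    move=> x y; apply: connect_trans (to_b x) _.
    rewrite (sym_connect_sym h_sym); apply: connect_trans (to_b y) _.
    apply: (connect_homo (e := t)) => // i i' ii'.
    by apply: connect1; rewrite b_adj.
  (* The truncated differences add up to the distance from [b_i] along its path, so ranks grow away
     from the backbone. *)
  pose R x := rho x.1 + ((x.2 - 1) + (1 - x.2)).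
  apply: (@ranked_acyclic _ _ R) => // x y z.
  rewrite /hang /R /disjoint_P4s /= =>
    /orP[/andP[/eqP xy yP]|/and3P[/eqP x1 /eqP y1 xy]].
    case/orP => [/andP[/eqP xz zP]|/and3P[/eqP x1 /eqP z1 xz]].
      rewrite xy -xy xz => l1 l2; apply: vertex_eq; first by rewrite -xy.
      have [lx ly lz] := And3 (ltn_ord x.2) (ltn_ord y.2) (ltn_ord z.2).
      by move: yP zP l1 l2 lx ly lz; clear; lia.
    rewrite xy x1 => l1 _; have ly := ltn_ord y.2.
    by move: yP l1 ly; rewrite x1; clear; lia.
  case/orP => [/andP[/eqP xz zP]|/and3P[_ /eqP z1 xz]].
    rewrite xz x1 => _ l1; have lz := ltn_ord z.2.
    by move: zP l1 lz; rewrite x1; clear; lia.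
  rewrite x1 y1 z1 !addn0 => l1 l2; apply: vertex_eq; last by rewrite y1 z1.
  exact: rk xy xz l1 l2.
- split=> //.
  + move=> x; rewrite /hang /disjoint_P4s /= eqxx t_irr !andbF orbF; clear; lia.
  + by move=> x y xy; rewrite /hang /= xy.
  + move=> x y; rewrite /hang /= !mem_b_set => /orP[-> //|/and3P[-> ->]//].
split.
  have b_in i : vertex_b i \in b_set k by rewrite mem_b_set.
  pose f i : {x | x \in b_set k} := exist _ (vertex_b i) (b_in i).
  have fE u : u = f (val u).1.
    by apply: val_inj; apply: vertex_eq => //=; have := valP u; rewrite mem_b_set =>
      /eqP.
  move=> u v; rewrite (fE u) (fE v); apply: (connect_homo (e := t)) => // i i' ii'.
  by apply: connect1; change (hang t (vertex_b i) (vertex_b i')); rewrite b_adj.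
apply: (@ranked_acyclic _ _ (fun u => rho (val u).1)).
  by move=> u v; apply: h_sym.
move=> u v w; have := valP u; have := valP v; have := valP w.
rewrite !mem_b_set => /eqP w1 /eqP v1 /eqP u1 uv uw l1 l2.
have uv' : t (val u).1 (val v).1 by rewrite -b_adj.
have uw' : t (val u).1 (val w).1 by rewrite -b_adj.
apply/val_inj/vertex_eq; last by rewrite v1 w1.
exact: rk uv' uw' l1 l2.
Qed.

End PathsOnTree.

(** * Tight graphs belong to the class *)

Section TightGraphs.
Variables (V : finType) (e : rel V).
Hypotheses (e_sym : symmetric e) (e_irr : irreflexive e).
Hypothesis e_conn : connected_graph e.
Hypothesis e_tight : ~ slack e (enum V).

Lemma tight_blocks : 2 < #|V| ->
  exists k (B : 'I_k -> nat -> V), 0 < k /\ blocks e B.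
Proof.
move=> n3; have [s [gs us sV]] := connected_grown e_conn (ltn_trans (isT : 0 < 2) n3).
have pe : perm_eq s (enum V).
  by apply: uniq_perm; rewrite ?enum_uniq // => x; rewrite mem_enum sV.
have s3 : 2 < size s by rewrite (perm_size pe) -cardE.
have [/(slack_perm pe)//|[qs qs4 pq]] := grown_slack_or_P4s e_sym gs s3 us.
have /card_gt0P[x0 _] : 0 < #|V| by lia.
exists (size qs), (fun i => nth x0 (nth [::] qs i)); split.
  by case: qs pq qs4 => // /perm_size /= E; rewrite E in s3.
have bE (i : 'I_(size qs)) : block (fun i => nth x0 (nth [::] qs i)) i = nth [::] qs i.
  have /P4_size : P4 e (nth [::] qs i) by apply: (allP qs4); apply: mem_nth.
  by rewrite /block; case: (nth [::] qs i) => [|a [|b [|c [|d [|? ?]]]]].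
split=> [|i]; last by rewrite bE; apply: (allP qs4); apply: mem_nth.
rewrite (eq_map bE) map_comp val_enum_ord -/(mkseq _ _) mkseq_nth.
by apply: perm_trans pq; rewrite perm_sym.
Qed.

Lemma graph_iso_vertex k (B : 'I_k -> nat -> V) (h : rel ('I_k * 'I_4)) :
  blocks e B -> (forall x y, h x y = e (vertex B x) (vertex B y)) ->
  graph_iso e h.
Proof.
move=> /vertex_bij[psi K K'] hE; exists psi; first by exists (vertex B).
by move=> x y; rewrite hE !K'.
Qed.

(** Contracting every block gives a connected graph on ['I_k]. Hanging the paths on a spanning tree
    of it gives the required tree, and the edges still missing join vertices [b_i]. *)
Lemma one_hub_in_G k (B : 'I_k -> nat -> V) : 0 < k -> blocks e B ->
  (forall i i' j j', i != i' -> j < 4 -> j' < 4 -> e (B i j) (B i' j') -> j = 1) ->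
  in_G e.
Proof.
move=> k0 bB hub; split=> //; right; exists k; split=> //.
pose r : rel 'I_k := [rel i i' | (i != i') && e (B i 1) (B i' 1)].
have hub2 (x y : 'I_k * 'I_4) : x.1 != y.1 -> e (vertex B x) (vertex B y) ->
    x.2 = 1 :> nat /\ y.2 = 1 :> nat.
  move=> xy exy; split; first by apply: hub exy.
  by rewrite e_sym in exy; apply: hub exy; rewrite // eq_sym.
have r_conn : connected_graph r.
  have [psi K K'] := vertex_bij bB.
  move=> i i'; have -> :
    i = (psi (B i 1)).1 by rewrite -[B i 1]/(vertex B (vertex_b i)) K.
  have -> : i' = (psi (B i' 1)).1 by rewrite -[B i' 1]/(vertex B (vertex_b i')) K.
  apply: (connect_homo (e := e) (f := fun v => (psi v).1)) => // u v uv.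
  have [->|ne] := eqVneq (psi u).1 (psi v).1; first exact: connect0.
  rewrite -(K' u) -(K' v) in uv; have [u1 v1] := hub2 _ _ ne uv.
  by apply: connect1; move: uv; rewrite /r /= ne /vertex u1 v1.
have r_sym : symmetric r by move=> i i'; rewrite /r /= eq_sym e_sym.
have r_irr : irreflexive r by move=> i; rewrite /r /= eqxx.
have [t [rho [tr t_sym t_conn rk]]] := spanning_tree r_conn r_sym r_irr.
exists (hang t).
  by apply: (hang_in_T _ t_sym t_conn rk) => i; apply/negP => /tr; rewrite r_irr.
have inE x y : x.1 = y.1 -> e (vertex B x) (vertex B y) = disjoint_P4s x y.
  by case: x y => [i j] [i' j'] /= <-;
    rewrite /disjoint_P4s /= eqxx /vertex (block_induced e_sym e_tight _ bB e_irr).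
exists [rel x y | e (vertex B x) (vertex B y)]; last exact: graph_iso_vertex bB _.
split=> /=.
- by move=> x y; rewrite /= e_sym.
- by move=> x; rewrite /= e_irr.
- move=> x y /= /orP[xy|/and3P[/eqP x1 /eqP y1 /tr /andP[_]]].
    by rewrite inE //; case/andP: xy => /eqP.
  by rewrite /vertex x1 y1.
- move=> x y /= exy; rewrite !mem_b_set; have [xy|ne _] := eqVneq x.1 y.1.
    by rewrite inE // in exy; rewrite /hang /= exy.
  by have [-> ->] := hub2 _ _ ne exy.
Qed.

Lemma twin_hub_in_G (B : 'I_2 -> nat -> V) : blocks e B ->
  e (B ord0 1) (B ord_max 1) -> e (B ord0 2) (B ord_max 2) -> in_G e.
Proof.
move=> bB e1 e2; split=> //; left; pose t : rel 'I_2 := [rel i i' | i != i'].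
exists (hang t).
  apply: (hang_in_T (rho := val)).
  - by move=> i; rewrite /t /= eqxx.
  - by move=> i i'; rewrite /t /= eq_sym.
  - move=> i i'; have [->|ne] := eqVneq i i'; first exact: connect0.
    exact: connect1.
  - by move=> [[|[|//]] ?] [[|[|//]] ?] [[|[|//]] ?] //= _ _ _ _; apply: val_inj.
apply: (graph_iso_vertex bB) => x y.
have [xy|ne] := eqVneq x.1 y.1.
  have -> : e (vertex B x) (vertex B y) = disjoint_P4s x y.
    by case: x y xy => [i j] [i' j'] /= <-;
      rewrite /disjoint_P4s /= eqxx /vertex (block_induced e_sym e_tight _ bB e_irr).
  case: x y xy => [i j] [i' j'] /= <-.
  rewrite /add_edge /hang /t /= eqxx !andbF orbF !xpair_eqE.
  by case: (i =P ord0) => [->|_]; case: (_ =P ord_max);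
    rewrite ?andbF /= ?orbF //= andbF orbF.
(* The two given links leave no room for further edges between the blocks. *)
have cross i i' (j j' : 'I_4) : i != i' -> e (B i 1) (B i' 1) -> e (B i 2) (B i' 2) ->
    e (B i j) (B i' j') = (j == j' :> nat) && ((j == 1 :> nat) || (j == 2 :> nat)).
  move=> ii' b1 b2; apply/idP/andP => [jj'|[/eqP<- /orP[]/eqP->]] //.
  have := block_cross_inner e_sym e_tight bB ii' (ltn_ord j) (ltn_ord j') jj'.
  rewrite !inE => j12; split=> //; apply/eqP.
  move: (ltn_ord j') jj' j12; move: (j : nat) (j' : nat) => m m' l' jj' /orP[] /eqP mE;
    rewrite mE in jj' *; symmetry.
    exact: (block_cross_inj e_sym e_tight bB ii' _ l' _ jj' b1).
  exact: (block_cross_inj e_sym e_tight bB ii' _ l' _ jj' b2).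
have crossE : e (vertex B x) (vertex B y) =
    (x.2 == y.2 :> nat) && ((x.2 == 1 :> nat) || (x.2 == 2 :> nat)).
  by apply: cross => //; have [[-> ->]|[-> ->]] := ord2_neq ne; rewrite // e_sym.
rewrite crossE; clear crossE cross e1 e2; case: x y ne => [i j] [i' j'] /= ii'.
rewrite /add_edge /hang /t /disjoint_P4s /= (negbTE ii') /= ?andbT !xpair_eqE -!val_eqE /=.
have : (i : nat) != i' by rewrite val_eqE.
have [li li' lj lj'] := And4 (ltn_ord i) (ltn_ord i') (ltn_ord j) (ltn_ord j').
by move: (i : nat) (i' : nat) (j : nat) (j' : nat) li li' lj lj'
  => [|[|//]] [|[|//]] [|[|[|[|//]]]] [|[|[|[|//]]]].
Qed.

(** If no block has outgoing edges at both inner vertices, reversals move all of them to position 1.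
    Otherwise two doubly linked blocks make up the whole graph. *)
Lemma tight_in_G : 2 < #|V| -> in_G e.
Proof.
move=> n3; have [k [B [k0 bB]]] := tight_blocks n3.
pose out i j := [exists y : 'I_k * 'I_4, (y.1 != i) && e (B i j) (vertex B y)].
have [/existsP[i /andP[/existsP[[i1 j1] /andP[/= n1 x1]] /existsP[[i2 j2] /andP[/= n2 x2]]]]|no2] :=
  boolP [exists i, out i 1 && out i 2]; last first.
  pose B' := flip (fun i => out i 2) B; have bB' : blocks e B' by apply: blocks_flip.
  apply: (one_hub_in_G k0 bB') => i i' j j' ii' j4 j4' xy.
  have := block_cross_inner e_sym e_tight bB' ii' j4 j4' xy.
  rewrite !in_cons orbF => /orP[/eqP//|/eqP jE]; rewrite jE in xy.
  have /existsPn/(_ i) := no2; rewrite negb_and.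
  (* An edge leaving at the new position 2 was at position 1 if [out i 2] holds, and at position 2
     otherwise; both are contradictory. *)
  have oE j0 : (if out i 2 then 3 - 2 else 2) = j0 -> out i j0.
    move=> E; apply/existsP.
    exists (i', inord (if out i' 2 then 3 - j' else j'));
      rewrite /= eq_sym ii' /vertex /= inordK.
      by rewrite -E.
    by case: (out i' 2); rewrite // ltnS leq_subr.
  by move: oE; case o2: (out i 2) => oE;
    [rewrite (oE 1 erefl) | rewrite (oE 2 erefl) in o2].
rewrite eq_sym in n1; rewrite eq_sym in n2; rewrite /vertex /= in x1 x2.
have i12 := block_cross_same e_sym e_tight bB n1 n2 (ltn_ord j1) (ltn_ord j2) x1 x2.
rewrite -{i2 n2}i12 in x2; move: i1 n1 x1 x2 => i' ii' x1 x2.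
have i'i : i' != i by rewrite eq_sym.
have x1' : e (B i' j1) (B i 1) by rewrite e_sym.
have x2' : e (B i' j2) (B i 2) by rewrite e_sym.
have := block_cross_inner e_sym e_tight bB i'i (ltn_ord j1) (isT : 1 < 4) x1'.
have := block_cross_inner e_sym e_tight bB i'i (ltn_ord j2) (isT : 2 < 4) x2'.
(* A common endpoint would be joined to both inner vertices of block [i]. *)
have : (j1 : nat) <> j2.
  move=> j12; rewrite -j12 in x2'.
  by have := block_cross_inj e_sym e_tight bB i'i (ltn_ord j1) (isT : 1 < 4) (isT :
    2 < 4) x1' x2'.
move: x1 x2 x1' x2'; move: (j1 : nat) (j2 : nat) => {}j1 {}j2 x1 x2 x1' x2' j12.
rewrite !inE => j2E j1E.
have [lj1 lj2] : j1 < 4 /\ j2 < 4 by clear -j1E j2E; lia.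
(* A block linked to [a'] at both inner vertices has no edge to a third block; by connectedness only
   two blocks exist. *)
have closed a a' p1 p2 b j j' : a != a' -> p1 < 4 -> p2 < 4 -> j < 4 -> j' < 4 ->
    e (B a 1) (B a' p1) -> e (B a 2) (B a' p2) -> e (B a j) (B b j') -> b = a \/ b = a'.
  move=> aa' l1 l2 l l' y1 y2 y; have [->|ba] := eqVneq b a; [by left|right].
  rewrite eq_sym in ba; have := block_cross_inner e_sym e_tight bB ba l l' y.
  rewrite !inE => /orP[] /eqP jE; rewrite jE in y.
    exact: (block_cross_same e_sym e_tight bB ba aa' l' l2 y y2).
  by rewrite (block_cross_same e_sym e_tight bB aa' ba l1 l' y1 y).
have [p1 [p2 [l1 l2 y1 y2]]] : exists p1 p2,
    [/\ p1 < 4, p2 < 4, e (B i' 1) (B i p1) & e (B i' 2) (B i p2)].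
  case/orP: j1E j12 => /eqP E1; case/orP: j2E => /eqP E2; rewrite E1 E2 // in x1' x2' *.
    by exists 1, 2.
  by exists 2, 1.
have two b : b = i \/ b = i'.
  have [psi K K'] := vertex_bij bB.
  have := e_conn (B i 1) (B b 1).
  have step u v : e u v -> (psi u).1 = i \/ (psi u).1 = i' ->
    (psi v).1 = i \/ (psi v).1 = i'.
    rewrite -{1}(K' u) -{1}(K' v) /vertex => uv [uE|uE]; rewrite uE in uv.
      exact: closed ii' lj1 lj2 (ltn_ord _) (ltn_ord _) x1 x2 uv.
    by have [] := closed _ _ _ _ _ _ _ i'i l1 l2 (ltn_ord _) (ltn_ord _) y1 y2 uv;
      [right|left].
  have : (psi (B i 1)).1 = i \/ (psi (B i 1)).1 = i'.
    by left; rewrite -[B i 1]/(vertex B (vertex_b i)) K.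
  move=> + /connectP[p]; elim: p (B i 1) => [|z p IH] u ui /=.
    by move=> _ E; move: ui; rewrite -E -[B b 1]/(vertex B (vertex_b b)) K.
  by case/andP=> uz pz; apply: IH pz; apply: step uz ui.
have k2 : k = 2.
  have : #|'I_k| = #|[set i; i']|.
    by apply: eq_card => b; rewrite !inE; have [->|->] := two b; rewrite eqxx ?orbT.
  by rewrite card_ord cards2 ii'.
subst k.
(* If the two links are crossed, reversing block [i'] uncrosses them. *)
pose B' := flip (fun a => (a == i') && (j1 == 2)) B.
have bB' : blocks e B' by apply: blocks_flip.
have [z1 z2] : e (B' i 1) (B' i' 1) /\ e (B' i 2) (B' i' 2).
  rewrite /B' /flip eqxx (negbTE ii') /=.
  by case/orP: j1E j12 => /eqP E1; case/orP: j2E => /eqP E2;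
    rewrite E1 E2 // in x1 x2 *.
have [iE|iE] := ord2_neq ii'.
- by case: iE => iE iE'; rewrite iE iE' in z1 z2; apply: twin_hub_in_G bB' z1 z2.
- case: iE => iE iE'; rewrite iE iE' e_sym in z1 z2; apply: twin_hub_in_G bB' _ _ => //.
  by rewrite e_sym.
Qed.

End TightGraphs.

(** * Lower bounds in the class *)

Section LowerBound.
Implicit Types (k : nat).

Definition supplied (V : finType) (e : rel V) (w : V -> nat) :=
  forall u, w u = 0 -> 2 <= \sum_(v | e u v) w v.

Lemma rainbow2_supplied (V : finType) (e : rel V) f :
  rainbow2_dominating e f -> supplied e (fun u => #|f u|).
Proof.
move=> /forallP dom u /eqP; rewrite cards_eq0 => fu.
have /eqP E := implyP (dom u) fu.
rewrite -[X in X <= _](card_ord 2) -cardsT -E.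
elim/big_rec2: _ => [|v n A _ le]; first by rewrite cards0.
by apply: leq_trans (leq_card_setU _ _) _; rewrite leq_add2l.
Qed.

Lemma roman_supplied (V : finType) (e : rel V) g :
  roman_dominating e g -> supplied e (fun u => g u).
Proof.
move=> /forallP dom u /eqP gu; have /existsP[v /andP[uv /eqP gv]] := implyP (dom u) gu.
by rewrite (bigD1 v) //= gv leq_addr.
Qed.

Lemma supplied_iso (V W : finType) (e : rel V) (h : rel W) w :
  graph_iso e h -> supplied e w ->
  exists2 w', supplied h w' & \sum_x w' x = \sum_u w u.
Proof.
move=> [phi [psi phiK psiK] eh] sw; exists (w \o psi) => /=.
  move=> x /sw /leq_trans; apply.
  rewrite (reindex phi) /=; last by exists psi => ? _; rewrite ?phiK ?psiK.
  rewrite (eq_bigl (fun v => h x (phi v))) => [|v]; last by rewrite -eh psiK.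
  by apply: eq_leq; apply: eq_bigr => v _; rewrite phiK.
rewrite (reindex phi) /=; last by exists psi => ? _; rewrite ?phiK ?psiK.
by apply: eq_bigr => v _; rewrite phiK.
Qed.

(** Reduces the supply condition at a vertex to an explicit list containing its neighbours. *)
Lemma sum_nbrs_le (W : finType) (h : rel W) (w : W -> nat) x s :
  (forall y, h x y -> y \in s) -> \sum_(y | h x y) w y <= \sum_(y <- s) w y.
Proof.
move=> hs; rewrite -big_filter.
apply: (sub_le_big_seq leqnn (fun m n => leq_addr n m)) => y.
rewrite count_uniq_mem ?filter_uniq ?index_enum_uniq // mem_filter.
by case: (boolP (h x y)) => //= /hs; rewrite -has_pred1 has_count; case: (_ \in _).
Qed.

Definition at_pos k (w : 'I_k * 'I_4 -> nat) i j := w (i, inord j).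

Section HungPaths.
Variables (k : nat) (t h : rel ('I_k * 'I_4)) (w : 'I_k * 'I_4 -> nat).
Hypothesis t_in : in_T t.

Lemma sum_blocks :
  \sum_x w x = \sum_i (at_pos w i 0 + at_pos w i 1 + at_pos w i 2 + at_pos w i 3).
Proof.
rewrite (eq_bigr (fun x => w (x.1, x.2))) => [|[] //].
rewrite -(pair_bigA _ (fun i j => w (i, j))); apply: eq_bigr => i _ /=.
rewrite !big_ord_recl big_ord0 addn0 !addnA /at_pos.
by do !congr (_ + _); congr (w (_, _)); apply: val_inj; rewrite /= inordK.
Qed.

Lemma path_nbr (x y : 'I_k * 'I_4) : disjoint_P4s x y ->
  [\/ y = (x.1, inord x.2.+1) /\ x.2 < 3 | y = (x.1, inord x.2.-1) /\ 0 < x.2].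
Proof.
move=> /andP[/eqP xy /orP[] /eqP E]; [left|right]; split.
- by apply: vertex_eq; rewrite //= inordK E.
- by have := ltn_ord y.2; rewrite -E.
- by apply: vertex_eq; rewrite //= inordK; rewrite -E //= ltnW.
- by rewrite -E.
Qed.

Lemma outer_nbr (x y : 'I_k * 'I_4) : x.2 != 1 :> nat -> t x y -> disjoint_P4s x y.
Proof.
move=> x1 xy; have [_ [_ _ _ Pt] _] := t_in.
by apply/negPn/negP => /(Pt x y xy)[]; rewrite mem_b_set (negbTE x1).
Qed.

Lemma path_nbr_mem (i : 'I_k) (j : 'I_4) y : disjoint_P4s (i, j) y ->
  y \in nth [::] [:: [:: (i, inord 1)]; [:: (i, inord 0); (i, inord 2)];
                     [:: (i, inord 1); (i, inord 3)]; [:: (i, inord 2)]] j.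
Proof.
case/path_nbr => -[->]; move: (j : nat) (ltn_ord j) => /=;
  by case=> [|[|[|[|//]]]] //= _ _; rewrite !inE eqxx ?orbT.
Qed.

Lemma supply_bound i (j : nat) s : supplied h w -> j < 4 ->
  (forall y, h (i, inord j) y -> y \in s) ->
  at_pos w i j = 0 -> 2 <= \sum_(y <- s) w y.
Proof. by move=> sw j4 hs /sw /leq_trans; apply; apply: sum_nbrs_le. Qed.

(** Only [b_i] has neighbours outside its path, and the conditions at [a_i], [c_i] and [d_i] already
    force weight 3 on that path. *)
Lemma one_hub_bound : adds_edges_in (b_set k) t h -> supplied h w ->
  3 * k <= \sum_x w x.
Proof.
move=> [_ _ _ th] sw.
have nbr i j y : j < 4 -> j != 1 -> h (i, inord j) y -> disjoint_P4s (i, inord j) y.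
  move=> j4 j1 hxy; have x1 : (i, inord j : 'I_4).2 != 1 :> nat by rewrite /= inordK.
  have [/(outer_nbr x1)//|nt] := boolP (t (i, inord j) y).
  by have [] := th _ _ hxy nt; rewrite mem_b_set (negbTE x1).
rewrite sum_blocks -[k in 3 * k]card_ord -sum1_card big_distrr /=.
apply: leq_sum => i _; rewrite muln1.
have b0 : at_pos w i 0 = 0 -> 2 <= at_pos w i 1.
  move=> w0; have := supply_bound (s := [:: (i, inord 1)]) sw (isT : 0 < 4) _ w0;
    rewrite big_seq1; apply.
  by move=> y /nbr-/(_ isT isT)/path_nbr_mem; rewrite inordK.
have b3 : at_pos w i 3 = 0 -> 2 <= at_pos w i 2.
  move=> w0; have := supply_bound (s := [:: (i, inord 2)]) sw (isT : 3 < 4) _ w0;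
    rewrite big_seq1; apply.
  by move=> y /nbr-/(_ isT isT)/path_nbr_mem; rewrite inordK.
have b2 : at_pos w i 2 = 0 -> 2 <= at_pos w i 1 + at_pos w i 3.
  move=> w0; have := supply_bound (s := [:: (i, inord 1); (i, inord 3)]) sw (isT :
    2 < 4) _ w0.
  rewrite big_cons big_seq1; apply.
  by move=> y /nbr-/(_ isT isT)/path_nbr_mem; rewrite inordK.
by move: b0 b2 b3; clear; lia.
Qed.

End HungPaths.

(** A single path may have weight 2 here, with 1 at both ends and its inner vertices supplied by the
    other path; hence the two paths are bounded together. *)
Lemma twin_hub_bound (t : rel ('I_2 * 'I_4)) w : in_T t ->
  supplied (add_edge t (vertex_c ord0) (vertex_c ord_max)) w -> 6 <= \sum_x w x.
Proof.
move=> t_in sw; set h := add_edge _ _ _ in sw.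
have [_ [t_sym t_irr _ Pt] _] := t_in.
have nbr i j y : j < 4 -> (j == 0) || (j == 3) ->
    h (i, inord j) y -> disjoint_P4s (i, inord j) y.
  move=> j4 j03 /or3P[|/andP[/eqP[_ /(congr1 val)]]|/andP[/eqP[_ /(congr1 val)]]].
  - by apply: outer_nbr => //=; rewrite inordK //; move: j03; clear; lia.
  - by rewrite /= inordK // => E; rewrite E in j03.
  - by rewrite /= inordK // => E; rewrite E in j03.
have nbr1 i i' y : i != i' -> h (i, inord 1) y ->
    y \in [:: (i, inord 0); (i, inord 2); (i', inord 1)].
  move=> ii' /or3P[|/andP[/eqP[_ /(congr1 val)]]|/andP[/eqP[_ /(congr1 val)]]];
    rewrite /= ?inordK // => xy.
  have [/path_nbr_mem|nP] := boolP (disjoint_P4s (i, inord 1) y).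
    by rewrite inordK //= !inE => /orP[]->; rewrite ?orbT.
  have [_] := Pt _ _ xy nP; rewrite mem_b_set => /eqP y1.
  have yi : y.1 != i.
    apply/eqP => yi; have yE : y = (i, inord 1) by apply: vertex_eq; rewrite //= inordK.
    by rewrite yE t_irr in xy.
  rewrite !inE; apply/or3P/Or33/eqP/vertex_eq; rewrite /= ?inordK //.
  by have [[E1 E2]|[E1 E2]] := ord2_neq ii'; have [[]|[]] := ord2_neq yi; rewrite E1 E2.
have nbr2 i i' y : i != i' -> h (i, inord 2) y ->
    y \in [:: (i, inord 1); (i, inord 3); (i', inord 2)].
  move=> ii'; have c2 (a : 'I_2) : vertex_c a = (a, inord 2).
    by rewrite /vertex_c; congr (_, _); apply: val_inj; rewrite /= inordK.
  rewrite /h /add_edge /= !c2 => /or3P[|/andP[/eqP[E] /eqP->]|/andP[/eqP[E] /eqP->]].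
  - move/(outer_nbr t_in)/path_nbr_mem; rewrite ?inordK //= => /(_ isT).
    by rewrite !inE => /orP[]->; rewrite ?orbT.
  - by have [[_ ->]|[E' _]] := ord2_neq ii';
    [rewrite !inE eqxx !orbT | rewrite E' in E].
  - by have [[E' _]|[_ ->]] := ord2_neq ii';
    [rewrite E' in E | rewrite !inE eqxx !orbT].
pose a := at_pos w.
have b0 i : a i 0 = 0 -> 2 <= a i 1.
  move=> w0; have := supply_bound (s := [:: (i, inord 1)]) sw (isT : 0 < 4) _ w0;
    rewrite big_seq1; apply.
  by move=> y /nbr-/(_ isT isT)/path_nbr_mem; rewrite inordK.
have b3 i : a i 3 = 0 -> 2 <= a i 2.
  move=> w0; have := supply_bound (s := [:: (i, inord 2)]) sw (isT : 3 < 4) _ w0;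
    rewrite big_seq1; apply.
  by move=> y /nbr-/(_ isT isT)/path_nbr_mem; rewrite inordK.
have b1 i i' : i != i' -> a i 1 = 0 -> 2 <= a i 0 + a i 2 + a i' 1.
  move=> ii' w0; have := supply_bound (s := [:: (i, inord 0); (i, inord 2);
    (i', inord 1)]) sw (isT : 1 < 4) _ w0.
  by rewrite !big_cons big_nil addn0 addnA; apply=> y; apply: nbr1.
have b2 i i' : i != i' -> a i 2 = 0 -> 2 <= a i 1 + a i 3 + a i' 2.
  move=> ii' w0; have := supply_bound (s := [:: (i, inord 1); (i, inord 3);
    (i', inord 2)]) sw (isT : 2 < 4) _ w0.
  by rewrite !big_cons big_nil addn0 addnA; apply=> y; apply: nbr2.
rewrite sum_blocks !big_ord_recl big_ord0 addn0 -/a.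
set i0 : 'I_2 := ord0; set i1 := lift _ _.
have i01 : i0 != i1 by [].
have i10 : i1 != i0 by [].
move: (b0 i0) (b0 i1) (b3 i0) (b3 i1) (b1 _ _ i01) (b1 _ _ i10) (b2 _ _ i01) (b2 _ _ i10).
clear; lia.
Qed.

(** Each kind of dominating function separately has weight at least 3/4 of the order, half of the
    claimed total. *)
Lemma in_G_bound (V : finType) (e : rel V) w : in_G e -> supplied e w ->
  3 * #|V| <= 4 * \sum_u w u.
Proof.
move=> [_ [[t tT iso]|[k [_ [t tT [h th iso]]]]]] sw.
  have [w' sw' <-] := supplied_iso iso sw.
  have -> : #|V| = 8 by have [phi /bij_eq_card-> _] := iso; rewrite card_prod !card_ord.
  by have := twin_hub_bound tT sw'; lia.
have [w' sw' <-] := supplied_iso iso sw.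
have -> : #|V| = k * 4 by have [phi /bij_eq_card-> _] := iso;
  rewrite card_prod !card_ord.
by have := one_hub_bound tT th sw'; lia.
Qed.

End LowerBound.

(** * From local costs to the two domination numbers *)

Lemma cost_gamma (V : finType) (e : rel V) n :
  cost e (enum V) n -> gamma_r2 e + gamma_R e <= n.
Proof.
move=> [f [g [fR gR]]]; apply: leq_trans; rewrite /weight !big_enum /=.
have inV u : u \in enum V by rewrite mem_enum.
apply: leq_add.
  have [_ /(_ (finfun f))] := gamma_r2P e.
  rewrite /rainbow_weight (eq_bigr (fun u => #|f u|)) => [|u _]; last by rewrite ffunE.
  apply; apply/forallP => u; apply/implyP; rewrite ffunE => /eqP fu.
  apply/eqP/setP => i; rewrite inE; apply/bigcupP.
  have [v _ /andP[uv iv]] := fR u (inV u) fu i.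
  by exists v; rewrite ?ffunE.
have g3 u : #|g u| < 3 by rewrite ltnS -[leqRHS](card_ord 2) max_card.
have [_ /(_ [ffun u => Ordinal (g3 u)])] := gamma_RP e.
rewrite /roman_weight (eq_bigr (fun u => #|g u|)) => [|u _]; last by rewrite ffunE.
apply; apply/forallP => u; apply/implyP; rewrite ffunE /= cards_eq0 => /eqP gu.
have [v _ /andP[uv /eqP gv]] := gR u (inV u) gu.
by apply/existsP; exists v; rewrite uv ffunE /= gv cardsT card_ord.
Qed.

Theorem theorem10 (V : finType) (e : rel V)
    (e_sym : symmetric e) (e_irr : irreflexive e)
    (e_conn : connected_graph e) (n_ge3 : (3 <= #|V|)%N) :
  ((gamma_r2 e)%:R + (gamma_R e)%:R <= 6 / 4 * #|V|%:R :> rat)%R /\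
  (((gamma_r2 e)%:R + (gamma_R e)%:R = 6 / 4 * #|V|%:R :> rat)%R <-> in_G e).
Proof.
have le : 2 * (gamma_r2 e + gamma_R e) <= 3 * #|V|.
  have [s [gs us sV]] := connected_grown e_conn (ltn_trans (isT : 0 < 2) n_ge3).
  have pe : perm_eq s (enum V).
    by apply: uniq_perm; rewrite ?enum_uniq // => x; rewrite mem_enum sV.
  have s3 : 2 < size s by rewrite (perm_size pe) -cardE.
  have [n /cost_gamma cn] := cheap_perm pe (grown_cheap e_sym gs s3 us).
  by rewrite -cardE; apply: leq_trans; rewrite leq_mul2l.
have eqG : 2 * (gamma_r2 e + gamma_R e) = 3 * #|V| <-> in_G e.
  split=> [eq|eG].
    (* Slack on all of [V] would push the sum strictly below the bound. *)
    apply: tight_in_G => // -[n /cost_gamma cn]; rewrite -cardE -eq.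
    by rewrite ltnNge leq_mul2l cn.
  (* The lower bound is applied to minimum functions of both kinds and combined with [le]. *)
  have [[[f fD fE] _] [[g gD gE] _]] := (gamma_r2P e, gamma_RP e).
  have := in_G_bound eG (rainbow2_supplied fD); have :=
    in_G_bound eG (roman_supplied gD).
  rewrite -/(rainbow_weight f) -/(roman_weight g) fE gE; lia.
have natE (m n : nat) : ((m%:R = n%:R :> rat)%R) <-> m = n.
  by split=> [/eqP|->//]; rewrite eqr_nat => /eqP.
split.
  have : ((2 * (gamma_r2 e + gamma_R e))%:R <= (3 * #|V|)%:R :> rat)%R by rewrite ler_nat.
  by rewrite !natrM natrD; lra.
rewrite -eqG -natE !natrM natrD; split; lra.
Qed.
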